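(* Let $G$ be a countable group which satisfies the centroid property, with space of centroids $(X,\mathrm{dist})$, base point $x_0\in X$ and length function $L(g)=\mathrm{dist}(x_0,g\cdot x_0)$. Then $G$ has property RD with respect to $L$.
   Context: All polynomials are assumed to have non-negative coefficients. Length function: a map $L\colon G\to[0,\infty)$ with $L(gh)\le L(g)+L(h)$, $L(g)=L(g^{-1})$ for all $g,h\in G$, and $L(1)=0$. Property RD: for finitely supported $\phi,\psi\colon G\to[0,\infty)$ put $\|\phi\|=\sqrt{\sum_{g\in G}\phi(g)^2}$, $\phi*\psi(k)=\sum_{g\in G}\phi(g)\psi(g^{-1}k)$, and $\mathrm{prop}(\phi)=\max\{L(g): \phi(g)\ne 0\}$. $G$ has property RD with respect to $L$ if there is a polynomial $P$ such that for every $r>0$ and all finitely supported $\phi,\psi\colon G\to[0,\infty)$ with $\mathrm{prop}(\phi)\le r$ one has $\|\phi*\psi\|^2\le P(r)\|\phi\|^2\|\psi\|^2$. Centroid property: let $G$ be a countable group acting by isometries on a metric space $(X,\mathrm{dist})$ with point stabilizers finite of uniformly bounded sizes, let $x_0\in X$ and $L(g)=\mathrm{dist}(x_0,g\cdot x_0)$. $G$ satisfies the centroid property (with space of centroids $X$ and centroid map $\mathfrak{c}$), if there are a map $\mathfrak{c}\colon G\times G\to X$ and a polynomial $P$ such that: ($c_1$) for every $k\in G$ and every $r>0$, the set $\{\mathfrak{c}(g,k): g\in G,\ L(g)\le r\}$ has at most $P(r)$ elements; ($c_2$) for every $g\in G$, the set $\{\mathfrak{c}(g,k): k\in G\}$ has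 at most $P(L(g))$ elements; ($c_3$) for every $h\in G$ and every $r>0$, the set $\{g^{-1}\cdot\mathfrak{c}(g,gh): g\in G,\ L(g)\le r\}$ has at most $P(r)$ elements. *)

(* Defs.v *)
From mathcomp Require Import all_boot all_order all_algebra finmap.
From mathcomp Require Import all_classical.
From mathcomp Require Import reals topology.

Set Implicit Arguments.
Unset Strict Implicit.
Unset Printing Implicit Defensive.

Import Order.TTheory GRing.Theory Num.Theory.

Local Open Scope card_scope.
Local Open Scope classical_set_scope.
Local Open Scope ring_scope.

(* A bound by a real number [c], such as a polynomial evaluated at a radius.  *)
(* Finiteness must be required separately: [fset_set A] is empty when [A] is  *)
(* infinite.                                                                  *)
Definition at_most {R : realType} {T : choiceType} (A : set T) (c : R) : Prop :=
  finite_set A /\ (#|` fset_set A|%fset)%:R <= c.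

Definition nneg_poly {R : realType} (P : {poly R}) : Prop :=
  P \is a polyOver Num.nneg.

Record length_function (R : realType) (G : groupType) := LengthFunction {
  length_val :> G -> R ;
  length_ge0 : forall g, 0 <= length_val g ;
  lengthM : forall g h, length_val (g * h)%g <= length_val g + length_val h ;
  lengthV : forall g, length_val g = length_val (g^-1)%g ;
  length1 : length_val 1%g = 0 }.

Section PropertyRD.
Context {R : realType} {G : groupType}.
Implicit Types phi psi : G -> R.

Definition supp phi : set G := [set g | phi g != 0].

Definition nneg_finsupp phi : Prop :=
  (forall g, 0 <= phi g) /\ finite_set (supp phi).

Definition l2norm phi : R := Num.sqrt (\sum_(g \in [set: G]) phi g ^+ 2).

Definition convolution phi psi : G -> R :=
  fun k => \sum_(g \in [set: G]) phi g * psi (g^-1 * k)%g.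

(* For finitely supported [phi != 0] the supremum is a maximum; for [phi = 0] *)
(* it is [sup set0 = 0].                                                      *)
Definition propagation (L : length_function R G) phi : R :=
  sup [set L g | g in supp phi].

Definition property_RD (L : length_function R G) : Prop :=
  exists2 P : {poly R}, nneg_poly P &
    forall r : R, 0 < r -> forall phi psi,
      nneg_finsupp phi -> nneg_finsupp psi -> propagation L phi <= r ->
      l2norm (convolution phi psi) ^+ 2
        <= P.[r] * l2norm phi ^+ 2 * l2norm psi ^+ 2.

End PropertyRD.

Record isometric_action (R : realType) (G : groupType) (X : metricType R) :=
  IsometricAction {
    act :> G -> X -> X ;
    act1 : forall x, act 1%g x = x ;
    actM : forall g h x, act (g * h)%g x = act g (act h x) ;
    act_isometry : forall g x y, mdist (act g x) (act g y) = mdist x y }.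

Section Centroids.
Context {R : realType} {G : groupType} {X : metricType R}.
Variables (a : isometric_action G X) (x0 : X).

Definition bounded_stabilizers : Prop :=
  exists N : nat, forall x : X, [set g | a g x = x] #<= `I_N.

Definition orbit_dist (g : G) : R := mdist x0 (a g x0).

Lemma orbit_dist_ge0 g : 0 <= orbit_dist g.
Proof. exact: mdist_ge0. Qed.

Lemma orbit_distM g h : orbit_dist (g * h)%g <= orbit_dist g + orbit_dist h.
Proof.
rewrite /orbit_dist actM -(act_isometry a g x0 (a h x0)).
exact: metric_triangle.
Qed.

Lemma orbit_distV g : orbit_dist g = orbit_dist (g^-1)%g.
Proof.
rewrite /orbit_dist -(act_isometry a g x0 (a g^-1%g x0)) -actM mulgV act1.
exact: metric_sym.
Qed.

Lemma orbit_dist1 : orbit_dist 1%g = 0.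
Proof. by rewrite /orbit_dist act1 mdistxx. Qed.

Definition orbit_length : length_function R G :=
  LengthFunction orbit_dist_ge0 orbit_distM orbit_distV orbit_dist1.

Definition centroid_property : Prop :=
  exists (c : G -> G -> X) (P : {poly R}), nneg_poly P /\
    [/\ forall (k : G) (r : R), 0 < r ->
          at_most [set c g k | g in [set g | orbit_length g <= r]] P.[r],
        forall g : G,
          at_most [set c g k | k in [set: G]] P.[orbit_length g] &
        forall (h : G) (r : R), 0 < r ->
          at_most [set a (g^-1)%g (c g (g * h)%g) |
                    g in [set g | orbit_length g <= r]] P.[r]].

End Centroids.

(* Main.v *)
Require Import Defs.
From mathcomp Require Import all_boot all_order all_algebra finmap.
From mathcomp Require Import all_classical reals topology.
From mathcomp Require Import ring.

(** The proof is a Cauchy-Schwarz argument organised by centroids.  Let [phi]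
be supported in the ball of radius [r] and write [p = P.[r]].

The value at [k] of the convolution is the sum over [g] of
[phi g * psi (g^-1 * k)].  Group its terms according to the centroid
[x = c g k].  By (c1) at most [p] centroids occur, so Cauchy-Schwarz over them
costs a factor [p]; a second Cauchy-Schwarz inside each group bounds the square
of the convolution at [k] by the sum over [x] of [p * W x * T k x], where

- [W x] is the sum of [phi g ^+ 2] over the [g] having [x] among their
  centroids, which no longer depends on [k];
- [T k x] is the sum of [psi (g^-1 * k) ^+ 2] over the [g] with [c g k = x].

By (c2) each [g] is counted in at most [p] of the [W x], so the [W x] add up to
at most [p] times the squared norm of [phi].  Now fix [x], sum [T k x] over [k],
and substitute [k = g * h]: each [psi h ^+ 2] is counted once for every [g] with
[c g (g * h) = x].  Such a [g] has [g^-1 x] in the set of (c3), which has at most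
[p] elements, and the [g] with a given value of [g^-1 x] form a coset of the
stabilizer of [x], which has at most [N] elements.  So [psi h ^+ 2] is counted at
most [N * p] times ([count_centroid_le]), and the polynomial [N * P ^+ 3] works
([convolution_sqr_le]).

All functions involved have finite support, so the estimate is carried out on
sums over duplicate-free sequences. *)

Import Order.TTheory GRing.Theory Num.Theory.

Local Open Scope card_scope.
Local Open Scope classical_set_scope.
Local Open Scope ring_scope.

(** * Counting and Cauchy-Schwarz over sequences *)

Lemma size_le_card_fset_set {T : choiceType} {A : set T} {s : seq T} :
  finite_set A -> uniq s -> {in s, forall x, A x} ->
  (size s <= #|` fset_set A|%fset)%N.
Proof.
move=> finA us sA; apply: uniq_leq_size => // x xs.
by rewrite in_fset_set// inE; exact: sA.
Qed.

Lemma at_most_size {R : realType} {T : choiceType} {A : set T} {c : R}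
    {s : seq T} :
  at_most A c -> uniq s -> {in s, forall x, A x} -> (size s)%:R <= c.
Proof.
move=> [finA Ac] us sA; apply: le_trans Ac.
by rewrite ler_nat; exact: size_le_card_fset_set.
Qed.

Lemma at_most_ge0 {R : realType} {T : choiceType} {A : set T} {c : R} :
  at_most A c -> 0 <= c.
Proof. by move=> Ac; apply: (@at_most_size _ _ _ _ [::] Ac). Qed.

Lemma big_fiber {R : Type} {idx : R} (op : Monoid.com_law idx) {I J : eqType}
    (s : seq I) (Y : seq J) (f : I -> J) (F : I -> R) :
  uniq Y -> {in s, forall i, f i \in Y} ->
  \big[op/idx]_(i <- s) F i =
    \big[op/idx]_(y <- Y) \big[op/idx]_(i <- s | f i == y) F i.
Proof.
move=> uY sY; rewrite (exchange_big_dep predT)//= big_seq [RHS]big_seq.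
apply: eq_bigr => i /sY fiY; rewrite -big_filter.
rewrite (eq_filter (a2 := pred1 (f i))) => [|y]; last by rewrite /= eq_sym.
by rewrite filter_pred1_uniq// big_seq1.
Qed.

Lemma size_le_fibers {I J : eqType} (s : seq I) (f : I -> J) (N : nat) :
  (forall y, (count (fun i => f i == y) s <= N)%N) ->
  (size s <= N * size (undup (map f s)))%N.
Proof.
move=> fibN; rewrite -sum1_size.
rewrite (big_fiber _ _ (undup (map f s)) f) ?undup_uniq//; last first.
  by move=> i si; rewrite mem_undup map_f.
apply: (@leq_trans (\sum_(y <- undup (map f s)) N)%N).
  by apply: leq_sum => y _; rewrite sum1_count.
by rewrite big_const_seq count_predT iter_addn_0.
Qed.

(** Lagrange's identity: twice the difference of the two sides is the double sum
of the squares [(u i * v j - u j * v i) ^+ 2]. *)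
Lemma Cauchy_Schwarz_seq {R : realFieldType} {I : Type} (s : seq I)
    (P : pred I) (u v : I -> R) :
  (\sum_(i <- s | P i) u i * v i) ^+ 2 <=
    (\sum_(i <- s | P i) u i ^+ 2) * (\sum_(i <- s | P i) v i ^+ 2).
Proof.
rewrite -(@ler_pMn2r _ 2)// mulr2n [leRHS]mulr2n.
rewrite [X in _ <= _ + X]mulrC expr2 !big_distrlr/= -!big_split/=.
apply: ler_sum => i _; rewrite -!big_split/=; apply: ler_sum => j _.
rewrite -subr_ge0.
suff -> : u i ^+ 2 * v j ^+ 2 + v i ^+ 2 * u j ^+ 2 -
    (u i * v i * (u j * v j) + u i * v i * (u j * v j)) =
    (u i * v j - u j * v i) ^+ 2 by exact: sqr_ge0.
by ring.
Qed.

(** Cauchy-Schwarz against the constant function 1 on the set of values of [f].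
Only the values actually taken count towards [n], while the right-hand side
ranges over an arbitrary larger [Y]: this lets [Y] be chosen independently of a
parameter on which [f] depends. *)
Lemma sqr_sum_le_fibers {R : realFieldType} {I J : eqType} (s : seq I)
    (Y : seq J) (f : I -> J) (F : I -> R) (n : R) :
  uniq Y -> {in s, forall i, f i \in Y} ->
  (size [seq y <- Y | y \in map f s])%:R <= n ->
  (\sum_(i <- s) F i) ^+ 2 <=
    n * \sum_(y <- Y) (\sum_(i <- s | f i == y) F i) ^+ 2.
Proof.
move=> uY sY Yn; set Y' := [seq y <- Y | y \in map f s] in Yn *.
have sY' : {in s, forall i, f i \in Y'}.
  by move=> i si; rewrite mem_filter map_f//= sY.
rewrite (big_fiber _ _ Y' f _ _ sY') ?filter_uniq//.
have := Cauchy_Schwarz_seq Y' predT (fun=> 1)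
  (fun y => \sum_(i <- s | f i == y) F i).
rewrite (eq_bigr _ (fun y _ => mul1r _)).
move=> /le_trans; apply.
apply: ler_pM.
- by apply: sumr_ge0 => y _; exact: sqr_ge0.
- by apply: sumr_ge0 => y _; exact: sqr_ge0.
- apply: le_trans Yn; under eq_bigr do rewrite expr1n.
  by rewrite -sum1_size natr_sum.
- rewrite big_filter big_mkcond; apply: ler_sum => y _.
  by case: ifP => // _; exact: sqr_ge0.
Qed.

Lemma fsbigT_seq {R : nmodType} {T : choiceType} {F : T -> R} {s : seq T} :
  uniq s -> (forall x, F x != 0 -> x \in s) ->
  \sum_(x \in [set: T]) F x = \sum_(x <- s) F x.
Proof.
move=> us Fs; rewrite [RHS]fsbig_seq//; apply/esym.
apply: (fsbig_widen [set` s] setT) => // x [_ /= sx].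
by apply/eqP/negPn/negP => /Fs.
Qed.

(** * Polynomials and finitely supported functions *)

Lemma nneg_poly_le {R : realType} (P : {poly R}) (x y : R) :
  nneg_poly P -> 0 <= x -> x <= y -> P.[x] <= P.[y].
Proof.
move=> /polyOverP P0 x0 xy; rewrite !horner_coef; apply: ler_sum => i _.
apply: ler_wpM2l; first by have := P0 i; rewrite nnegrE.
by rewrite lerXn2r ?nnegrE// (le_trans x0).
Qed.

Section FiniteSupport.
Context {R : realType} {G : groupType}.
Implicit Types phi : G -> R.

Lemma nneg_finsupp_seq {phi} : nneg_finsupp phi ->
  exists2 A : seq G, uniq A & forall g, (g \in A) = (phi g != 0).
Proof.
move=> [_ /finite_seqP[s sE]]; exists (undup s); first exact: undup_uniq.
move=> g; rewrite mem_undup; apply/idP/idP => gs.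
  by have : supp phi g by rewrite sE.
by have : [set` s] g by rewrite -sE.
Qed.

(** Finiteness of the support is what makes the supremum an upper bound: [sup]
is 0 on unbounded sets. *)
Lemma propagation_ub (L : length_function R G) phi (r : R) :
  finite_set (supp phi) -> propagation L phi <= r ->
  forall g, phi g != 0 -> L g <= r.
Proof.
move=> fphi phir g gphi; apply: le_trans phir; apply: ub_le_sup; last by exists g.
have : finite_set [set L g | g in supp phi] by exact: finite_image.
(* The sum of the absolute values is a convenient bound for a finite set. *)
move=> /finite_seqP[s ->]; exists (\sum_(x <- s) `|x|) => x /= xs.
rewrite (big_rem x)//= (le_trans (ler_norm x))// lerDl.
by apply: sumr_ge0 => y _; exact: normr_ge0.
Qed.

Lemma l2norm_sqr phi (s : seq G) :
  uniq s -> (forall g, phi g != 0 -> g \in s) ->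
  l2norm phi ^+ 2 = \sum_(g <- s) phi g ^+ 2.
Proof.
move=> us phis; rewrite /l2norm (fsbigT_seq us); last first.
  by move=> g; rewrite sqrf_eq0; exact: phis.
by rewrite sqr_sqrtr//; apply: sumr_ge0 => g _; exact: sqr_ge0.
Qed.

End FiniteSupport.

(** * The convolution estimate *)

Section Estimate.
Context {R : realType} {G : groupType} {X : metricType R}.
Variable a : isometric_action G X.

Lemma actVK g x : a g (a (g^-1)%g x) = x.
Proof. by rewrite -actM mulgV act1. Qed.

(** If [g0^-1 x = y], then [g^-1 x = y] if and only if [g * g0^-1] fixes [x], so
the [g] counted here inject into the stabilizer of [x]. *)
Lemma count_act_inv_le (N : nat) (A : seq G) (x y : X) :
  [set g | a g x = x] #<= `I_N -> uniq A ->
  (count (fun g => a (g^-1)%g x == y) A <= N)%N.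
Proof.
move=> stabN uA; rewrite -size_filter.
set F := [seq g <- A | _]; have uF : uniq F by rewrite filter_uniq.
have FP g : g \in F -> a (g^-1)%g x = y.
  by rewrite mem_filter => /andP[/eqP].
case EF : F => [//|g0 F']; rewrite -EF.
have g0y : a (g0^-1)%g x = y by apply: FP; rewrite EF mem_head.
rewrite -(size_map (fun g => g * g0^-1)%g).
apply: leq_trans (geq_card_fset_set stabN).
apply: size_le_card_fset_set.
- by apply/finite_set_leP; exists N.
- by rewrite map_inj_uniq// => g h /mulIg.
- by move=> _ /mapP[g /FP gy ->] /=; rewrite actM g0y -gy actVK.
Qed.

(** If [c g (g * h) = x], then [g^-1 x] belongs to the set bounded by (c3), and
each value of [g^-1 x] comes from at most [N] elements [g]. *)
Lemma count_centroid_le (c : G -> G -> X) (N : nat) (A : seq G) (S : set G)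
    (p : R) (h : G) (x : X) :
  [set g | a g x = x] #<= `I_N -> uniq A -> {in A, forall g, S g} ->
  at_most [set a (g^-1)%g (c g (g * h)%g) | g in S] p ->
  (count (fun g => c g (g * h)%g == x) A)%:R <= N%:R * p.
Proof.
move=> stabN uA AS c3; rewrite -size_filter; set F := [seq g <- A | _].
have uF : uniq F by rewrite filter_uniq.
have := size_le_fibers F (fun g => a (g^-1)%g x) N
  (fun y => count_act_inv_le N F x y stabN uF).
rewrite -(ler_nat R) => /le_trans; apply.
rewrite natrM ler_wpM2l//; apply: (at_most_size c3); first exact: undup_uniq.
move=> y; rewrite mem_undup => /mapP[g]; rewrite mem_filter => /andP[/eqP gx gA].
by move=> ->; exists g; [exact: AS | rewrite gx].
Qed.

Lemma sum_reindex_mulg (A B K : seq G) (g : G) (F : G -> R) :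
  uniq B -> uniq K -> (forall h, F h != 0 -> h \in B) ->
  {in B, forall h, (g * h)%g \in K} ->
  \sum_(k <- K) F (g^-1 * k)%g = \sum_(h <- B) F h.
Proof.
move=> uB uK FB BK.
rewrite -(big_map (fun k => g^-1 * k)%g predT F) -(fsbigT_seq uB FB).
apply/esym/fsbigT_seq; first by rewrite map_inj_uniq// => ? ? /mulgI.
by move=> h /FB /BK gK; apply/mapP; exists (g * h)%g; rewrite ?mulKg.
Qed.

(** The inner sum is the convolution at [k] once [phi] vanishes outside [A], and
[K] then contains the support of the convolution.  The three bounds by [p] are (c1), (c2)
and (c3) with the ball of radius [r] replaced by [A].  One factor [p] comes from
each of them, and [N] from the stabilizers. *)
Lemma convolution_sqr_le (c : G -> G -> X) (N : nat) (p : R)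
    (A B K : seq G) (phi psi : G -> R) :
  (forall x, [set g | a g x = x] #<= `I_N) ->
  uniq A -> uniq B -> uniq K ->
  (forall h, psi h != 0 -> h \in B) ->
  {in A & B, forall g h, (g * h)%g \in K} ->
  (forall k, at_most [set c g k | g in [set` A]] p) ->
  {in A, forall g, at_most [set c g k | k in [set: G]] p} ->
  (forall h, at_most [set a (g^-1)%g (c g (g * h)%g) | g in [set` A]] p) ->
  \sum_(k <- K) (\sum_(g <- A) phi g * psi (g^-1 * k)%g) ^+ 2 <=
    N%:R * p ^+ 3 * (\sum_(g <- A) phi g ^+ 2) * (\sum_(h <- B) psi h ^+ 2).
Proof.
move=> stabN uA uB uK psiB ABK c1 c2 c3.
have p0 : 0 <= p by exact: at_most_ge0 (c1 1%g).
set Y := undup [seq c g k | g <- A, k <- K].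
have uY : uniq Y by exact: undup_uniq.
pose T k x := \sum_(g <- A | c g k == x) psi (g^-1 * k)%g ^+ 2.
pose W x := \sum_(g <- A | x \in map (c g) K) phi g ^+ 2.
have T0 k x : 0 <= T k x by apply: sumr_ge0 => g _; exact: sqr_ge0.
have W0 x : 0 <= W x by apply: sumr_ge0 => g _; exact: sqr_ge0.
(* Enlarging the condition [c g k = x] to [x \in map (c g) K] in the [phi]
   factor removes its dependence on [k]. *)
have convW k : k \in K ->
    (\sum_(g <- A) phi g * psi (g^-1 * k)%g) ^+ 2 <=
    p * \sum_(x <- Y) W x * T k x.
  move=> kK; apply: le_trans (sqr_sum_le_fibers A Y (c^~ k) _ p uY _ _) _.
  - by move=> g gA; rewrite mem_undup; exact: allpairs_f.
  - apply: (at_most_size (c1 k)); first by rewrite filter_uniq.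
    move=> x; rewrite mem_filter => /andP[/mapP[g gA ->] _].
    by exists g.
  - apply: ler_wpM2l => //; apply: ler_sum => x _.
    apply: le_trans (Cauchy_Schwarz_seq _ _ _ _) _.
    apply: ler_wpM2r; first exact: T0.
    rewrite /W big_mkcond [leRHS]big_mkcond/=; apply: ler_sum => g _.
    case: ifPn => [/eqP <-|_]; first by rewrite map_f.
    by case: ifP => // _; exact: sqr_ge0.
(* Substituting [k = g * h] turns the sum over [k] into a weighted sum of the
   [psi h ^+ 2], with the weights bounded by [count_centroid_le]. *)
have sumT x : \sum_(k <- K) T k x <= N%:R * p * \sum_(h <- B) psi h ^+ 2.
  rewrite /T; under eq_bigr do rewrite big_mkcond/=.
  rewrite exchange_big/=.
  pose F g h := if c g (g * h)%g == x then psi h ^+ 2 else 0.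
  rewrite (eq_big_seq (fun g => \sum_(h <- B) F g h)); last first.
    move=> g gA; rewrite -(sum_reindex_mulg A B K g (F g) uB uK).
    - by apply: eq_bigr => k _; rewrite /F mulVKg.
    - move=> h; rewrite /F; case: ifP; last by rewrite eqxx.
      by rewrite sqrf_eq0 => _; exact: psiB.
    - by move=> h; exact: ABK.
  rewrite exchange_big/= mulr_sumr; apply: ler_sum => h _.
  rewrite /F -big_mkcond/= big_const_seq iter_addr_0 -[leLHS]mulr_natl.
  apply: ler_wpM2r; first exact: sqr_ge0.
  exact: (count_centroid_le c N A [set` A] p h x).
(* Exchanging the sums, [phi g ^+ 2] appears once per centroid of [g]. *)
have sumW : \sum_(x <- Y) W x <= p * \sum_(g <- A) phi g ^+ 2.
  rewrite /W; under eq_bigr do rewrite big_mkcond/=.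
  rewrite exchange_big/= mulr_sumr big_seq [leRHS]big_seq.
  apply: ler_sum => g gA.
  rewrite -big_mkcond/= big_const_seq iter_addr_0 -[leLHS]mulr_natl.
  apply: ler_wpM2r; first exact: sqr_ge0.
  rewrite -size_filter; apply: (at_most_size (c2 g gA)).
    by rewrite filter_uniq.
  by move=> x; rewrite mem_filter => /andP[/mapP[k _ ->] _]; exists k.
rewrite big_seq; apply: le_trans (ler_sum _ convW) _; rewrite -big_seq.
rewrite -mulr_sumr exchange_big/=; under eq_bigr do rewrite -mulr_sumr.
set Phi := \sum_(g <- A) _; set Psi := \sum_(h <- B) _.
have Psi0 : 0 <= Psi by apply: sumr_ge0 => h _; exact: sqr_ge0.
have -> : N%:R * p ^+ 3 * Phi * Psi = p * (p * Phi * (N%:R * p * Psi)) by ring.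
apply: ler_wpM2l => //.
apply: (@le_trans _ _ ((\sum_(x <- Y) W x) * (N%:R * p * Psi))).
  by rewrite mulr_suml; apply: ler_sum => x _; exact: ler_wpM2l.
by apply: ler_wpM2r => //; rewrite !mulr_ge0.
Qed.

End Estimate.

Theorem theorem2p3 (R : realType) (G : groupType) (X : metricType R)
    (a : isometric_action G X) (x0 : X) :
  countable [set: G] ->
  bounded_stabilizers a ->
  centroid_property a x0 ->
  property_RD (orbit_length a x0).
Proof.
move=> _ [N stabN] [c [P [P0 [c1 c2 c3]]]].
exists (N%:R *: P ^+ 3).
  by apply: polyOverZ; [rewrite nnegrE | exact: rpredX].
move=> r r0 phi psi phiF psiF phir.
have [A uA AE] := nneg_finsupp_seq phiF.
have [B uB BE] := nneg_finsupp_seq psiF.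
have Ar := propagation_ub _ _ _ phiF.2 phir.
set L := orbit_length a x0 in c1 c2 c3 Ar *.
have {}Ar : [set` A] `<=` [set g | L g <= r].
  by move=> g /=; rewrite AE; exact: Ar.
have convE k :
    convolution phi psi k = \sum_(g <- A) phi g * psi (g^-1 * k)%g.
  apply: fsbigT_seq => // g; rewrite mulf_eq0 negb_or => /andP[].
  by rewrite AE.
set K := undup [seq (g * h)%g | g <- A, h <- B].
have ABK : {in A & B, forall g h, (g * h)%g \in K}.
  by move=> g h gA hB; rewrite mem_undup; exact: allpairs_f.
rewrite (l2norm_sqr phi A)//; last by move=> g; rewrite AE.
rewrite (l2norm_sqr psi B)//; last by move=> g; rewrite BE.
rewrite (l2norm_sqr _ K) ?undup_uniq//; last first.
  move=> k; apply: contraNT => kK; rewrite convE big_seq big1// => g gA.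
  apply/eqP; rewrite mulf_eq0; apply/orP; right.
  apply: contraNT kK; rewrite -BE => hB.
  by rewrite -(mulVKg g k); exact: ABK.
under eq_bigr do rewrite convE.
rewrite hornerZ horner_exp.
(* The hypotheses bound sets indexed by a ball; only the part indexed by the
   support of [phi], which lies in the ball of radius [r], is needed. *)
have at_most_sub (T : choiceType) (f : G -> T) (S S' : set G) (p q : R) :
    S `<=` S' -> p <= q -> at_most [set f g | g in S'] p ->
    at_most [set f g | g in S] q.
  move=> SS' pq [fin le_p]; have sub := image_subset f SS'.
  have finS := sub_finite_set sub fin.
  split=> //; apply: le_trans pq; apply: le_trans le_p; rewrite ler_nat.
  by apply: fsubset_leq_card; rewrite -fset_set_sub.
apply: (convolution_sqr_le a c N) => //.
- exact: undup_uniq.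
- by move=> h; rewrite BE.
- by move=> k; exact: at_most_sub (c1 k r r0).
- move=> g gA; apply: at_most_sub (c2 g) => //.
  by apply: nneg_poly_le; [| exact: length_ge0 | exact: Ar].
- by move=> h; exact: at_most_sub (c3 h r r0).
Qed.
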